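(* Let $\mathsf{FAMT}_w\subset\mathcal{A}$ be the $\mathbb{Q}$-vector space generated by all finite alternating multiple $T$-values of weight $w$. Then the following are generating sets of $\mathsf{FAMT}_w$ for $w<3$, where $\langle\cdots\rangle$ denotes the $\mathbb{Q}$-span in $\mathcal{A}$: $$\mathsf{FAMT}_1=\langle \mathtt{q}_2,\ (-1)^{p'}\mathtt{q}_2\rangle,\qquad \mathsf{FAMT}_2=\langle G_{\mathcal{A}},\ (-1)^{p'}G_{\mathcal{A}}\rangle.$$
   Context: $\mathbb{N}$ is the set of positive integers, $\mathcal{P}$ the set of primes, and $\mathcal{A}:=\prod_{p\in\mathcal{P}}(\mathbb{Z}/p\mathbb{Z})\big/\bigoplus_{p\in\mathcal{P}}(\mathbb{Z}/p\mathbb{Z})$, a $\mathbb{Q}$-algebra in which an element is determined by its components for all but finitely many $p$. Finite alternating multiple $T$-values: for $\mathbf{s}=(s_1,\dots,s_d)\in\mathbb{N}^d$ and $\boldsymbol{\sigma}=(\sigma_1,\dots,\sigma_d)\in\{\pm1\}^d$ (all $\sigma_j=1$ allowed), $$T_{\mathcal{A}}(\mathbf{s};\boldsymbol{\sigma}):=\Bigg(\sum_{\substack{p>n_1>\dots>n_d>0\\ n_j\equiv d-j+1\ (\mathrm{mod}\ 2)}}\ \prod_{j=1}^d\frac{\sigma_j^{(n_j-d+j-1)/2}}{n_j^{s_j}}\ (\mathrm{mod}\ p)\Bigg)_{p\in\mathcal{P}}\in\mathcal{A},$$ with weight $s_1+\cdots+s_d$. $\mathtt{q}_2:=\big(\tfrac{2^{p-1}-1}{p}\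 (\mathrm{mod}\ p)\big)_{3\le p\in\mathcal{P}}$ is the Fermat quotient. The finite Catalan's constant is $G_{\mathcal{A}}:=\big(\tfrac{E_{p-3}}{2}\ (\mathrm{mod}\ p)\big)_{3<p\in\mathcal{P}}$, where $E_n$ are the Euler numbers, $\frac{2}{e^t+e^{-t}}=\sum_{n\ge0}E_n\frac{t^n}{n!}$. Here $(-1)^{p'}$ denotes the element $\big((-1)^{(p-1)/2}\ (\mathrm{mod}\ p)\big)_{3\le p\in\mathcal{P}}$ of $\mathcal{A}$, i.e. $p'=(p-1)/2$. *)

(* Defs.v *)
From HB Require Import structures.
From mathcomp Require Import all_boot all_order all_algebra.
From mathcomp Require Import boolp classical_sets functions cardinality.
Set Implicit Arguments.
Unset Strict Implicit.
Unset Printing Implicit Defensive.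
Import Order.TTheory GRing.Theory Num.Theory.
Local Open Scope ring_scope.
Local Open Scope quotient_scope.

Definition prime_index := {p : nat | prime p}.

Definition prodF : Type := forall p : prime_index, 'F_(val p).

HB.instance Definition _ := Choice.on prodF.

Section ProdFRing.
Implicit Types f g h : prodF.
Let zero : prodF := fun p => 0.
Let one : prodF := fun p => 1.
Let opp f : prodF := fun p => - f p.
Let add f g : prodF := fun p => f p + g p.
Let mul f g : prodF := fun p => f p * g p.
Let addA : associative add.
Proof. by move=> f g h; apply: functional_extensionality_dep => p; exact: addrA. Qed.
Let addC : commutative add.
Proof. by move=> f g; apply: functional_extensionality_dep => p; exact: addrC. Qed.
Let add0 : left_id zero add.
Proof. by move=> f; apply: functional_extensionality_dep => p; exact: add0r. Qed.
Let addN : left_inverse zero opp add.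
Proof. by move=> f; apply: functional_extensionality_dep => p; exact: addNr. Qed.
HB.instance Definition _ := GRing.isZmodule.Build prodF addA addC add0 addN.
Let mulA : associative mul.
Proof. by move=> f g h; apply: functional_extensionality_dep => p; exact: mulrA. Qed.
Let mulC : commutative mul.
Proof. by move=> f g; apply: functional_extensionality_dep => p; exact: mulrC. Qed.
Let mul1 : left_id one mul.
Proof. by move=> f; apply: functional_extensionality_dep => p; exact: mul1r. Qed.
Let mulD : left_distributive mul add.
Proof. by move=> f g h; apply: functional_extensionality_dep => p; exact: mulrDl. Qed.
Let one_neq0 : one != zero.
Proof.
apply/eqP => /(congr1 (fun f : prodF => f (exist _ 2 isT))).
by move/eqP; rewrite oner_eq0.
Qed.
HB.instance Definition _ :=
  GRing.Zmodule_isComNzRing.Build prodF mulA mulC mul1 mulD one_neq0.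
End ProdFRing.

Definition dsumF : {pred prodF} :=
  fun f => `[< finite_set [set p : prime_index | f p != 0] >].

Lemma dsumFP (f : prodF) :
  reflect (exists N, forall p : prime_index, (N < val p)%N -> f p = 0)
          (f \in dsumF).
Proof.
apply: (iffP (asboolP _)) => [fin|[N fN]].
  have /finite_seqP[s sE] := fin.
  exists (\max_(p <- s) val p)%N => p lp.
  apply/eqP/negPn/negP => fp.
  have ps : p \in s.
    by have : [set` s]%classic p by rewrite -sE.
  by move: lp; rewrite ltnNge; apply/negP/negPn; exact: leq_bigmax_seq.
apply/(sub_finite_set (B := val @^-1` [set` iota 0 N.+1])).
  move=> p /= fp; suff : (val p <= N)%N by rewrite -ltnS -[(_ < N.+1)%N](mem_iota 0).
  by rewrite leqNgt; apply: contraNN fp => /fN ->.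
by apply: finite_preimage => // x y _ _; exact: val_inj.
Qed.

Lemma dsumF_idealr : idealr_closed dsumF.
Proof.
split.
- by apply/dsumFP; exists 0%N.
- apply/dsumFP => -[N HN].
  have [p Np pp] := prime_above N.
  by have /eqP := HN (exist _ p pp) Np; rewrite oner_eq0.
- move=> a f g /dsumFP[N fN] /dsumFP[M gM]; apply/dsumFP.
  exists (maxn N M) => p; rewrite gtn_max => /andP[Np Mp].
  rewrite -[LHS]/(a p * f p + g p).
  by rewrite fN // gM // mulr0 addr0.
Qed.

HB.instance Definition _ := isIdealr.Build prodF dsumF dsumF_idealr.

Definition A : Type := {ideal_quot dsumF}.

HB.instance Definition _ := GRing.ComNzRing.on A.

Definition toA (f : prodF) : A := \pi_({ideal_quot dsumF}) f.

Lemma toA_eqP (f g : prodF) :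
  (toA f = toA g) <->
  (exists N, forall p : prime_index, (N < val p)%N -> f p = g p).
Proof.
rewrite /toA; split.
  move/eqP; rewrite -Quotient.idealrBE => /dsumFP[N HN].
  by exists N => p /HN H; apply/eqP; rewrite -subr_eq0; apply/eqP.
case=> N HN; apply/eqP; rewrite -Quotient.idealrBE; apply/dsumFP.
by exists N => p /HN H; rewrite -[LHS]/(f p - g p) H subrr.
Qed.

Lemma toAD (f g : prodF) : toA f + toA g = toA (fun p => f p + g p).
Proof. exact/esym/(rmorphD (\pi_({ideal_quot dsumF}))). Qed.

Lemma toAM (f g : prodF) : toA f * toA g = toA (fun p => f p * g p).
Proof. exact/esym/(rmorphM (\pi_({ideal_quot dsumF}))). Qed.

Lemma toA1 : toA (fun p => 1) = 1.
Proof. exact: (rmorph1 (\pi_({ideal_quot dsumF}))). Qed.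

Lemma intrF_neq0 (m : int) : m != 0 ->
  forall p : prime_index, (`|m|%N < val p)%N -> (m%:~R : 'F_(val p)) != 0.
Proof.
move=> m0 [p pp] /= mp.
have: ((`|m|%N)%:R : 'F_p) != 0.
  rewrite -(dvdn_pcharf (pchar_Fp pp)); apply/negP => /dvdn_leq.
  by rewrite absz_gt0 m0 leqNgt mp => /(_ isT).
by case: m {m0 mp} => n //=; rewrite NegzE mulrNz oppr_eq0.
Qed.

Lemma ratr_frac (F : fieldType) (a b : int) (r : rat) :
  (denq r)%:~R != 0 :> F -> b%:~R != 0 :> F -> r * b%:~R = a%:~R ->
  ratr r = a%:~R / b%:~R :> F.
Proof.
move=> d0 b0 rE; rewrite /ratr; apply/eqP; rewrite eqr_div //.
rewrite -!rmorphM /=; apply/eqP; congr (_%:~R).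
apply: (@intr_inj rat); rewrite !rmorphM /= -rE numqE.
by rewrite mulrAC.
Qed.

(* [ratr] is not a morphism at the finitely many p dividing a denominator;
   those are invisible in A. *)
Definition ratA (r : rat) : A := toA (fun p => ratr r).

Lemma ratA1 : ratA 1 = 1.
Proof.
rewrite -toA1; apply/toA_eqP; exists 0%N => p _.
by rewrite /ratr divr1.
Qed.

Lemma ratAM : {morph ratA : r s / r * s}.
Proof.
move=> r s; rewrite /ratA toAM; apply/toA_eqP.
exists (maxn `|denq r| (maxn `|denq s| `|denq (r * s)|))%N => p.
rewrite !gtn_max => /and3P[rp sp rsp].
have dr := intrF_neq0 (denq_neq0 _) rp.
have ds := intrF_neq0 (denq_neq0 _) sp.
have drs := intrF_neq0 (denq_neq0 _) rsp.
rewrite (@ratr_frac _ (numq r * numq s) (denq r * denq s)) //.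
- by rewrite /ratr !rmorphM /= mulf_div.
- by rewrite rmorphM mulf_neq0.
- by rewrite !rmorphM /= !numqE mulrACA.
Qed.

Lemma ratAD : {morph ratA : r s / r + s}.
Proof.
move=> r s; rewrite /ratA toAD; apply/toA_eqP.
exists (maxn `|denq r| (maxn `|denq s| `|denq (r + s)|))%N => p.
rewrite !gtn_max => /and3P[rp sp rsp].
have dr := intrF_neq0 (denq_neq0 _) rp.
have ds := intrF_neq0 (denq_neq0 _) sp.
have drs := intrF_neq0 (denq_neq0 _) rsp.
rewrite (@ratr_frac _ (numq r * denq s + numq s * denq r) (denq r * denq s)) //.
- by rewrite /ratr rmorphD !rmorphM /= addf_div.
- by rewrite rmorphM mulf_neq0.
- by rewrite rmorphD !rmorphM /= !numqE mulrDl !mulrA [in X in _ + X]mulrAC.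
Qed.

Section AAlgebra.
Let scale (r : rat) (a : A) : A := ratA r * a.
Let scaleA r s a : scale r (scale s a) = scale (r * s) a.
Proof. by rewrite /scale ratAM mulrA. Qed.
Let scale1 : left_id 1 scale.
Proof. by move=> a; rewrite /scale ratA1 mul1r. Qed.
Let scaleDr : right_distributive scale +%R.
Proof. by move=> r a b; rewrite /scale mulrDr. Qed.
Let scaleDl a : {morph scale^~ a : r s / r + s}.
Proof. by move=> r s; rewrite /scale ratAD mulrDl. Qed.
HB.instance Definition _ :=
  GRing.Zmodule_isLmodule.Build rat A scaleA scale1 scaleDr scaleDl.
Let scaleAl (r : rat) (a b : A) : r *: (a * b) = r *: a * b.
Proof. by rewrite -[LHS]/(ratA r * (a * b)) mulrA. Qed.
HB.instance Definition _ := GRing.Lmodule_isLalgebra.Build rat A scaleAl.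
HB.instance Definition _ := GRing.Lalgebra_isComAlgebra.Build rat A.
End AAlgebra.

Lemma scaleAE (r : rat) (a : A) : r *: a = ratA r * a.
Proof. by []. Qed.

Definition lin_span (R : pzRingType) (V : lmodType R) (S : set V) : set V :=
  [set a | exists (m : nat) (c : 'I_m -> R) (v : 'I_m -> V),
     (forall i, S (v i)) /\ a = \sum_(i < m) c i *: v i].

(* Indices are 0-based: the j-th component here is the (j+1)-st one of the
   usual notation, so that "d - j + 1" becomes [d - j]. *)
Definition T_index (d : nat) (n : 'I_d -> nat) : bool :=
  [&& [forall i : 'I_d, forall j : 'I_d, (i < j)%N ==> (n j < n i)%N],
      [forall j, (0 < n j)%N]
    & [forall j : 'I_d, (n j == d - j %[mod 2])%N]].

(* On the range of summation n_j >= d - j, so the subtraction is exact. *)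
Definition T_A (d : nat) (s : 'I_d -> nat) (sigma : 'I_d -> int) : A :=
  toA (fun p =>
    \sum_(n : {ffun 'I_d -> 'I_(val p)} | T_index (fun j => n j : nat))
      \prod_(j < d)
        ((sigma j)%:~R ^+ ((n j - (d - j))./2)%N / (n j)%:R ^+ s j)).

Definition FAMT (w : nat) : set A :=
  lin_span [set a : A | exists (d : nat) (s : 'I_d -> nat) (sigma : 'I_d -> int),
    [/\ forall j, (0 < s j)%N,
        forall j, sigma j = 1 \/ sigma j = -1,
        (\sum_(j < d) s j)%N = w
      & a = T_A s sigma]].

(* The quotient is exact for odd p; the component at 2 is irrelevant. *)
Definition q2_A : A := toA (fun p => ((2 ^ (val p).-1 - 1) %/ val p)%N%:R).

(* Floor division: the exponent is (p - 1) / 2 for odd p. *)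
Definition sgn_A : A := toA (fun p => (-1) ^+ ((val p).-1./2)%N).

(* Formal power series over rat, as coefficient sequences. *)
Definition fps_mul (f g : nat -> rat) (n : nat) : rat :=
  \sum_(k < n.+1) f (n - k)%N * g k.

Fixpoint fps_inv_coefs (f : nat -> rat) (n : nat) : seq rat :=
  if n is m.+1 then
    let u := fps_inv_coefs f m in
    rcons u ((f 0%N)^-1 * ((m == 0%N)%:R - \sum_(k < m) f (m - k)%N * u`_k))
  else [::].

Definition fps_inv (f : nat -> rat) (n : nat) : rat :=
  (fps_inv_coefs f n.+1)`_n.

Lemma size_fps_inv_coefs f n : size (fps_inv_coefs f n) = n.
Proof. by elim: n => //= n IH; rewrite size_rcons IH. Qed.

Lemma nth_fps_inv_coefs f n k : (k < n)%N ->
  (fps_inv_coefs f n)`_k = fps_inv f k.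
Proof.
elim: n => // n IH; rewrite ltnS leq_eqVlt => /predU1P[->//|kn].
by rewrite /= nth_rcons size_fps_inv_coefs kn IH.
Qed.

Lemma fps_mul_inv f : f 0%N != 0 ->
  forall n, fps_mul f (fps_inv f) n = (n == 0%N)%:R.
Proof.
move=> f0 n; rewrite /fps_mul big_ord_recr /= subnn.
rewrite [X in _ + _ * X]/fps_inv /= nth_rcons size_fps_inv_coefs ltnn eqxx.
rewrite mulVKf // addrC -addrA.
under [X in _ + (- X + _)]eq_bigr => k _ do rewrite nth_fps_inv_coefs //.
by rewrite addNr addr0.
Qed.

Definition fps_exp (a : rat) (n : nat) : rat := a ^+ n / n`!%:R.

(* E_n / n! is the coefficient of t^n in 2 / (e^t + e^-t). *)
Definition euler_number (n : nat) : rat :=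
  n`!%:R * (2 * fps_inv (fun k => fps_exp 1 k + fps_exp (-1) k) n).

Lemma euler_number_gf n :
  fps_mul (fun k => fps_exp 1 k + fps_exp (-1) k)
    (fun k => euler_number k / k`!%:R) n = (if n == 0%N then 2 else 0).
Proof.
have f0 : fps_exp 1 0 + fps_exp (-1) 0 != 0 by [].
transitivity
  (2 * fps_mul (fun k => fps_exp 1 k + fps_exp (-1) k)
         (fps_inv (fun k => fps_exp 1 k + fps_exp (-1) k)) n).
  rewrite /fps_mul mulr_sumr; apply: eq_bigr => k _.
  rewrite /euler_number [_`!%:R * _]mulrC mulfK ?pnatr_eq0 -?lt0n ?fact_gt0 //.
  by rewrite mulrCA.
by rewrite (fps_mul_inv f0); case: (n == 0%N); rewrite ?mulr1 ?mulr0.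
Qed.

(* The components at p = 2, 3 are irrelevant. For p > 3, [ratr] is reduction
   mod p, since the Euler numbers are integers. *)
Definition G_A : A := toA (fun p => ratr (euler_number (val p - 3)%N / 2)).

(* Main.v *)
(* Write chi n for the imaginary part of i ^ n and, for a prime p > 3, put
   eps = (-1) ^ ((p - 1) / 2).

   Weight 1: expanding 2 ^ p = (1 + 1) ^ p modulo p ^ 2 gives T(1; 1) = q_2.
   Doing the same with (1 + i) ^ p, whose imaginary part has square 2 ^ (p - 1),
   gives 2 T(1; -1) = eps q_2.

   Weight 2, depth 1: T(2; 1) = 0.  The umbral functional L : X ^ k |-> E_k
   satisfies L (f (X + 1) + f (X - 1)) = 2 f(0), so the sum of
   chi n * n ^ (p - 3) over n < p telescopes; this is T(2; -1) = G.

   Weight 2, depth 2: let x = T(1, 1; 1, -1).  Shuffle and reversal relations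
   give T(1, 1; 1, 1) = 0, T(1, 1; -1, -1) = -2 x and T(1, 1; -1, 1) = -eps x;
   combined with the stuffle relations for products of single sums with
   parity and chi weights, they give 2 x = -G, the contributions of q_2 ^ 2
   cancelling out. *)
Require Import Defs.
From mathcomp Require Import all_boot all_order all_algebra.
From mathcomp Require Import boolp classical_sets functions cardinality.
From mathcomp Require Import zify ring.
Set Implicit Arguments.
Unset Strict Implicit.
Unset Printing Implicit Defensive.
Import Order.TTheory GRing.Theory Num.Theory.
Local Open Scope ring_scope.

(** * Parity weights and binomial sums of powers of i *)

Definition evenr {R : pzRingType} (n : nat) : R := (~~ odd n)%:R.
Definition oddr {R : pzRingType} (n : nat) : R := (odd n)%:R.

(* The powers of an imaginary unit i: i ^ n = psi n + i chi n. *)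
Definition psi {R : pzRingType} (n : nat) : R :=
  (~~ odd n)%:R * (-1) ^+ odd n./2.
Definition chi {R : pzRingType} (n : nat) : R :=
  (odd n)%:R * (-1) ^+ odd n./2.

(** Halving a difference borrows exactly when [m] is odd and [n] even. Together with [oddB] this
    determines the class of [n - m] modulo 4 from parity bits of [m] and [n]. *)
Lemma odd_halfB m n : (m <= n)%N ->
  odd (n - m)./2 = odd n./2 (+) odd m./2 (+) (odd m && ~~ odd n).
Proof. lia. Qed.

(** Pascal's rule. For the weights [chi] and [psi] it amounts to multiplying (1 + i)^n by 1 + i. *)
Lemma sum_binS (R : pzRingType) (f : nat -> R) n :
  \sum_(k < n.+2) f k * 'C(n.+1, k)%:R =
  \sum_(k < n.+1) f k * 'C(n, k)%:R + \sum_(k < n.+1) f k.+1 * 'C(n, k)%:R.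
Proof.
rewrite big_ord_recl /= bin0.
under eq_bigr => k _ do rewrite /bump add1n binS natrD mulrDr.
rewrite big_split addrA; congr (_ + _).
rewrite -(bin0 n) -(big_ord_recl n.+1 (fun k => f k * 'C(n, k)%:R)).
by rewrite big_ord_recr /= bin_small // mulr0 addr0.
Qed.

Lemma odd_halfS n : odd n.+1./2 = odd n./2 (+) odd n.
Proof. lia. Qed.

Lemma chiS (R : pzRingType) n : chi n.+1 = psi n :> R.
Proof.
by rewrite /chi /psi odd_halfS /=; case: (odd n); rewrite ?mul0r ?addbF.
Qed.

Lemma psiS (R : pzRingType) n : psi n.+1 = - chi n :> R.
Proof.
rewrite /chi /psi odd_halfS /=; case: (odd n); rewrite /= ?mul0r ?oppr0 //.
by rewrite !mul1r addbT; case: (odd _); rewrite ?expr0 ?expr1 ?opprK.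
Qed.

Lemma sum_bin_chiS (R : pzRingType) n :
  \sum_(k < n.+2) chi k * 'C(n.+1, k)%:R =
  \sum_(k < n.+1) chi k * 'C(n, k)%:R +
  \sum_(k < n.+1) psi k * 'C(n, k)%:R :> R.
Proof.
by rewrite sum_binS; congr (_ + _); apply: eq_bigr => k _; rewrite chiS.
Qed.

Lemma sum_bin_psiS (R : pzRingType) n :
  \sum_(k < n.+2) psi k * 'C(n.+1, k)%:R =
  \sum_(k < n.+1) psi k * 'C(n, k)%:R -
  \sum_(k < n.+1) chi k * 'C(n, k)%:R :> R.
Proof.
rewrite sum_binS -sumrN; congr (_ + _); apply: eq_bigr => k _.
by rewrite psiS mulNr.
Qed.

(* The sums are the imaginary and real parts of (1 + i) ^ (2 j + 1), and
   (1 + i) ^ 2 = 2 i. *)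
Lemma sum_bin_chi_psi j :
  (\sum_(k < j.*2.+2) chi k * 'C(j.*2.+1, k)%:R) ^+ 2 = 2 ^+ j.*2 :> int /\
  (\sum_(k < j.*2.+2) psi k * 'C(j.*2.+1, k)%:R) ^+ 2 = 2 ^+ j.*2 :> int.
Proof.
elim: j => [|j [IHchi IHpsi]].
  by rewrite !big_ord_recl !big_ord0.
rewrite doubleS !(sum_bin_chiS, sum_bin_psiS) [2 ^+ _]exprS [2 ^+ _]exprS.
by split; [rewrite -IHpsi sum_bin_psiS | rewrite -IHchi sum_bin_chiS]; ring.
Qed.

Lemma sum_chi (R : pzRingType) (g : nat -> R) N :
  \sum_(1 <= n < N.*2.+1) chi n * g n = \sum_(k < N) (-1) ^+ k * g k.*2.+1.
Proof.
elim: N => [|N IHN]; first by rewrite big_geq ?big_ord0.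
rewrite doubleS big_nat_recr //= big_nat_recr //= IHN big_ord_recr /=.
by rewrite /chi /= odd_double !mul0r addr0 mul1r uphalf_double signr_odd.
Qed.

(** * Euler numbers *)

Section EulerNumbers.

(** Compare coefficients of t^n in the generating function identity and multiply by n!/2: 1 +
    (-1)^(n-k) is twice a parity indicator. *)
Lemma euler_number_rec n :
  \sum_(k < n.+1) 'C(n, k)%:R * (~~ odd (n - k))%:R * euler_number k =
  (n == 0%N)%:R.
Proof.
have := congr1 (fun x => n`!%:R * x) (euler_number_gf n).
rewrite /fps_mul mulr_sumr => E.
apply: (mulfI (x := 2)) => //; rewrite mulr_sumr.
transitivity (n`!%:R * (if n == 0%N then 2 else 0 : rat)); last first.
  by case: n E => [|n] _; rewrite /= ?mulr0 ?fact0 ?mul1r ?mulr1.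
rewrite -E; apply: eq_bigr => k _.
have kn : (k <= n)%N by rewrite -ltnS.
rewrite -(bin_fact kn) !natrM /fps_exp expr1n -signr_odd.
have k0 : k`!%:R != 0 :> rat by rewrite pnatr_eq0 -lt0n fact_gt0.
have nk0 : (n - k)`!%:R != 0 :> rat by rewrite pnatr_eq0 -lt0n fact_gt0.
by case: (odd _); rewrite /= ?expr0 ?expr1; field; rewrite k0 nk0.
Qed.

Lemma euler_numberE n :
  euler_number n = (n == 0%N)%:R -
    \sum_(k < n) 'C(n, k)%:R * (~~ odd (n - k))%:R * euler_number k.
Proof.
rewrite -(euler_number_rec n) big_ord_recr /= subnn binn !mul1r.
by rewrite addrAC subrr add0r.
Qed.

Lemma euler_number_int n : euler_number n \is a Num.int.
Proof.
elim/ltn_ind: n => n IHn; rewrite euler_numberE rpredB ?rpred_nat //.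
apply: rpred_sum => k _; apply: rpredM; last exact: IHn.
by apply: rpredM; apply: rpred_nat.
Qed.

(** The recursion links only indices of equal parity, and its inhomogeneous term sits at n = 0. *)
Lemma euler_number_odd n : odd n -> euler_number n = 0.
Proof.
elim/ltn_ind: n => n IHn n_odd; rewrite euler_numberE.
rewrite big1 ?subr0; first by case: n n_odd {IHn}.
move=> k _; rewrite oddB 1?ltnW // n_odd /= negbK.
by case: (boolP (odd k)) => [/IHn->|]; rewrite ?mulr0 ?mul0r.
Qed.

Variable K : fieldType.

(* Euler numbers are integers, so taking the numerator loses nothing. *)
Definition eulerK n : K := (numq (euler_number n))%:~R.

Lemma eulerK_rec n :
  \sum_(k < n.+1) 'C(n, k)%:R * (~~ odd (n - k))%:R * eulerK k =
  (n == 0%N)%:R.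
Proof.
have : \sum_(k < n.+1) 'C(n, k)%:R * (~~ odd (n - k))%:R *
    numq (euler_number k) = (n == 0%N)%:R.
  apply: (@intr_inj rat); rewrite rmorph_sum rmorph_nat -euler_number_rec.
  apply: eq_bigr => k _; rewrite !rmorphM /= !rmorph_nat.
  by rewrite numqK ?euler_number_int.
move/(congr1 (fun z : int => z%:~R : K)); rewrite rmorph_sum rmorph_nat => <-.
by apply: eq_bigr => k _; rewrite !rmorphM /= !rmorph_nat.
Qed.

Lemma eulerK_odd n : odd n -> eulerK n = 0.
Proof. by move=> n_odd; rewrite /eulerK euler_number_odd. Qed.

(* The umbral functional sending 'X^k to the Euler number E_k. *)
Definition umbral (f : {poly K}) : K := \sum_(i < size f) f`_i * eulerK i.

Lemma umbralE N (f : {poly K}) : (size f <= N)%N ->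
  umbral f = \sum_(i < N) f`_i * eulerK i.
Proof.
move=> fN; rewrite /umbral (big_ord_widen N (fun i => f`_i * eulerK i) fN).
rewrite big_mkcond; apply: eq_bigr => i _; case: ltnP => // fi.
by rewrite nth_default // mul0r.
Qed.

Lemma umbralD : {morph umbral : f g / f + g}.
Proof.
move=> f g; pose N := maxn (size f) (size g).
rewrite !(umbralE (N := N)) ?size_polyD ?leq_maxl ?leq_maxr //.
by rewrite -big_split; apply: eq_bigr => i _; rewrite coefD mulrDl.
Qed.

Lemma umbralZ c (f : {poly K}) : umbral (c *: f) = c * umbral f.
Proof.
rewrite !(umbralE (N := size f)) ?size_scale_leq // mulr_sumr.
by apply: eq_bigr => i _; rewrite coefZ mulrA.
Qed.

Lemma umbral0 : umbral 0 = 0.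
Proof. by rewrite -(scale0r 0) umbralZ mul0r. Qed.

Lemma umbral_sum (I : Type) (r : seq I) (F : I -> {poly K}) :
  umbral (\sum_(i <- r) F i) = \sum_(i <- r) umbral (F i).
Proof. exact: (big_morph _ umbralD umbral0). Qed.

Lemma umbralXn n : umbral 'X^n = eulerK n.
Proof.
rewrite (umbralE (N := n.+1)) ?size_polyXn // big_ord_recr /= coefXn eqxx.
rewrite mul1r big1 ?add0r // => i _.
by rewrite coefXn ltn_eqF // mul0r.
Qed.

(** Stated for arbitrary [f], so that it applies both to ['X] and to the already shifted polynomials
    X + 1 and X - 1. *)
Lemma umbral_shift c (f : {poly K}) n :
  umbral ((c%:P + f) ^+ n) =
  \sum_(k < n.+1) 'C(n, k)%:R * c ^+ (n - k) * umbral (f ^+ k).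
Proof.
rewrite exprDn umbral_sum; apply: eq_bigr => k _.
by rewrite -rmorphXn mul_polyC -scaler_nat scalerA umbralZ.
Qed.

Lemma umbral_pm1 n :
  umbral ((1%:P + 'X) ^+ n) + umbral (((-1)%:P + 'X) ^+ n) =
  2%:R * (n == 0%N)%:R.
Proof.
rewrite -eulerK_rec mulr_sumr !umbral_shift -big_split; apply: eq_bigr => k _ /=.
rewrite umbralXn expr1n -signr_odd.
by case: (odd _); rewrite ?expr0 ?expr1 /=; ring.
Qed.

(** Expand in powers of X + 1 and X - 1. By [umbral_pm1] only the term k = 0 survives. *)
Lemma umbral_succ_pred c n :
  umbral (((c + 1)%:P + 'X) ^+ n) + umbral (((c - 1)%:P + 'X) ^+ n) =
  2%:R * c ^+ n.
Proof.
rewrite !polyCD -!addrA !umbral_shift -big_split big_ord_recl /= -mulrDr umbral_pm1.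
rewrite bin0 subn0 eqxx mulr1 mul1r mulrC big1 ?addr0 // => k _.
by rewrite -mulrDr umbral_pm1 !mulr0.
Qed.

(** A telescoping sum: [umbral_succ_pred] at c = 2N + 1 writes 2 (2N + 1)^n as the sum of the umbral
    values at the shifts 2N + 2 and 2N. *)
Lemma sum_odd_pow n N :
  2%:R * \sum_(k < N) (-1) ^+ k * (k.*2.+1)%:R ^+ n =
  eulerK n - (-1) ^+ N * umbral ((N.*2%:R%:P + 'X) ^+ n).
Proof.
elim: N => [|N IHN].
  by rewrite big_ord0 mulr0 expr0 mul1r polyC0 add0r umbralXn subrr.
rewrite big_ord_recr /= mulrDr IHN mulrCA -umbral_succ_pred exprS.
have -> : N.*2.+1%:R - 1 = N.*2%:R :> K by rewrite -natr1 addrK.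
have -> : N.*2.+1%:R + 1 = N.+1.*2%:R :> K by rewrite natr1 doubleS.
ring.
Qed.

(** As the odd Euler numbers vanish, for even n the shifts by 1 and -1 have the same umbral value.
    The two values add up to 0 by [umbral_pm1]. *)
Lemma umbral_opp1 n : 2%:R != 0 :> K -> (0 < n)%N -> ~~ odd n ->
  umbral (((-1)%:P + 'X) ^+ n) = 0.
Proof.
move=> two_neq0 n_gt0 n_even; apply: (mulfI two_neq0).
have n0 : (n == 0%N)%:R = 0 :> K by rewrite gtn_eqF.
have := umbral_pm1 n; rewrite n0 mulr0 => E; rewrite -[RHS]E mulr_natl.
rewrite mulr2n; congr (_ + _).
rewrite !umbral_shift; apply: eq_bigr => k _; rewrite umbralXn.
case: (boolP (odd k)) => [/eulerK_odd->|k_even]; first by rewrite !mulr0.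
have kn : (k <= n)%N by rewrite -ltnS.
by rewrite expr1n -signr_odd oddB // (negPf n_even) (negPf k_even).
Qed.

End EulerNumbers.

(** * Harmonic sums in characteristic p *)

Section HarmonicSums.
Variables (K : fieldType) (p : nat).
Hypothesis pK : p \in [pchar K].
Implicit Types (f g : nat -> K) (phi : nat -> nat -> K).

Definition hsum f : K := \sum_(1 <= n < p) f n / n%:R.

Definition hsum2 f : K := \sum_(1 <= n < p) f n / n%:R ^+ 2.

Definition dsum phi : K :=
  \sum_(1 <= n < p) \sum_(1 <= m < p | (m < n)%N) phi m n / (m%:R * n%:R).

Lemma natr_neq0 n : (0 < n < p)%N -> n%:R != 0 :> K.
Proof.
move=> /andP[n0 np]; rewrite -(dvdn_pcharf pK).
by apply/negP => /(dvdn_leq n0); rewrite leqNgt np.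
Qed.

Lemma natrB_char n : (n <= p)%N -> (p - n)%:R = - n%:R :> K.
Proof. by move=> np; rewrite natrB // (pcharf0 pK) sub0r. Qed.

(** The weak bound [n <= p] is the side condition under which the parity of [p - n] can be
    expanded. *)
Lemma eq_hsum f g :
  (forall n, (0 < n)%N -> (n <= p)%N -> f n = g n) -> hsum f = hsum g.
Proof. by move=> fg; apply: eq_big_nat => n /andP[n0 /ltnW/(fg n n0)->]. Qed.

Lemma eq_hsum2 f g :
  (forall n, (0 < n)%N -> (n <= p)%N -> f n = g n) -> hsum2 f = hsum2 g.
Proof. by move=> fg; apply: eq_big_nat => n /andP[n0 /ltnW/(fg n n0)->]. Qed.

Lemma eq_dsum phi psi :
  (forall m n, (0 < m)%N -> (m <= n)%N -> (m <= p)%N -> (n <= p)%N ->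
    phi m n = psi m n) ->
  dsum phi = dsum psi.
Proof.
move=> eq_phi; apply: eq_big_nat => n /andP[_ np].
rewrite big_nat_cond [RHS]big_nat_cond; apply: eq_bigr => m.
by move=> /andP[/andP[m0 mp] mn]; rewrite eq_phi // ltnW.
Qed.

Lemma hsumD f g : hsum (fun n => f n + g n) = hsum f + hsum g.
Proof. by rewrite /hsum -big_split; apply: eq_bigr => n _; rewrite mulrDl. Qed.

Lemma hsumZ c f : hsum (fun n => c * f n) = c * hsum f.
Proof. by rewrite /hsum mulr_sumr; apply: eq_bigr => n _; rewrite mulrA. Qed.

Lemma hsum2D f g : hsum2 (fun n => f n + g n) = hsum2 f + hsum2 g.
Proof. by rewrite /hsum2 -big_split; apply: eq_bigr => n _; rewrite mulrDl. Qed.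

Lemma dsumZ c phi : dsum (fun m n => c * phi m n) = c * dsum phi.
Proof.
rewrite /dsum mulr_sumr; apply: eq_bigr => n _ /=.
by rewrite mulr_sumr; apply: eq_bigr => m _ /=; rewrite mulrA.
Qed.

Lemma sum_rev (P : pred nat) f :
  \sum_(1 <= n < p | P n) f n = \sum_(1 <= n < p | P (p - n)%N) f (p - n)%N.
Proof.
by rewrite big_nat_rev; apply: eq_big => n; rewrite add1n subSS.
Qed.

Lemma hsum_rev f : hsum f = - hsum (fun n => f (p - n)%N).
Proof.
rewrite /hsum sum_rev -sumrN; apply: eq_big_nat => n /andP[_ np].
by rewrite natrB_char 1?ltnW // invrN mulrN.
Qed.

Lemma hsum2_rev f : hsum2 f = hsum2 (fun n => f (p - n)%N).
Proof.
rewrite /hsum2 sum_rev; apply: eq_big_nat => n /andP[_ np].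
by rewrite natrB_char 1?ltnW // sqrrN.
Qed.

Lemma dsum_exchange phi :
  dsum phi =
  \sum_(1 <= m < p) \sum_(1 <= n < p | (m < n)%N) phi m n / (m%:R * n%:R).
Proof. exact: (exchange_big_dep xpredT). Qed.

(** Replacing n by p - n reverses the order of the two indices, hence the swapped arguments. The two
    signs from the denominators cancel. *)
Lemma dsum_rev phi : dsum phi = dsum (fun m n => phi (p - n)%N (p - m)%N).
Proof.
rewrite [RHS]dsum_exchange {1}/dsum sum_rev.
apply: eq_big_nat => n /andP[n0 np]; rewrite sum_rev.
rewrite big_nat_cond [RHS]big_nat_cond; apply: eq_big => m.
  by apply: andb_id2l => /andP[m0 mp]; lia.
move=> /andP[/andP[m0 mp] _].
by rewrite !natrB_char 1?ltnW // mulrNN [m%:R * _]mulrC.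
Qed.

(** The product of two sums splits into the regions m < n, n < m and m = n. *)
Lemma dsum_stuffle f g :
  dsum (fun m n => f m * g n) + dsum (fun m n => g m * f n) +
    hsum2 (fun n => f n * g n) = hsum f * hsum g.
Proof.
rewrite [X in X + _ + _]dsum_exchange /dsum /hsum2 /hsum big_distrl /=.
rewrite -!big_split; apply: eq_big_nat => m /andP[m0 mp] /=.
have mI : m \in index_iota 1 p by rewrite mem_index_iota m0.
rewrite big_distrr /= [RHS](bigID (fun n => (m < n)%N)) /=.
rewrite -addrA; congr (_ + _); first by apply: eq_bigr => n _; rewrite mulf_div.
rewrite [RHS](bigID (fun n => (n < m)%N)) /=; congr (_ + _).
  apply: eq_big => n; first by lia.
  by move=> _; rewrite mulf_div mulrC [g n * _]mulrC [n%:R * _]mulrC mulrC.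
(* What remains is the diagonal: the single term n = m, every other index being excluded by the two
   negated inequalities. *)
rewrite (big_rem m) //= ltnn big1_seq ?addr0 ?mulf_div ?expr2 //.
move=> n /andP[mn]; rewrite mem_rem_uniq ?iota_uniq // inE.
by case/andP=> nm _; move: mn nm; case: ltngtP.
Qed.

Lemma sum_shift m f : (m < p)%N ->
  \sum_(1 <= n < p | (m + n < p)%N) f n =
  \sum_(1 <= n < p | (m < n)%N) f (n - m)%N.
Proof.
move=> mp.
transitivity (\sum_(1 <= n < p - m) f n).
  rewrite [RHS](big_nat_widen _ _ p) ?leq_subr //.
  by apply: eq_bigl => n /=; lia.
transitivity (\sum_(m.+1 <= n < p) f (n - m)%N).
  rewrite -[m.+1]add1n big_addn; apply: eq_bigr => n _.
  by rewrite addnK.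
by rewrite (big_nat_widenl _ 1).
Qed.

(* Evaluates the sum of phi a b / (a b) over a + b < p in two ways: by
   1 / (a b) = (1 / a + 1 / b) / (a + b), and by the substitution b = p - n. *)
Lemma dsum_shuffle phi :
  dsum (fun m n => phi m (n - m)%N) + dsum (fun m n => phi (n - m)%N m) +
    dsum (fun m n => phi m (p - n)%N) = 0.
Proof.
pose S psi := \sum_(1 <= a < p) \sum_(1 <= b < p | (a + b < p)%N)
  (psi a b : K) / (a%:R * (a + b)%:R).
have SE psi : S psi = dsum (fun m n => psi m (n - m)%N).
  rewrite dsum_exchange; apply: eq_big_nat => a /andP[a0 ap].
  rewrite (sum_shift _ ap) //; apply: eq_bigr => n an.
  by rewrite subnKC 1?ltnW.
rewrite -[X in X + _ + _]SE -[X in _ + X + _](SE (fun a b => phi b a)).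
have -> : S (fun a b => phi b a) = \sum_(1 <= a < p)
    \sum_(1 <= b < p | (a + b < p)%N) phi a b / (b%:R * (a + b)%:R).
  rewrite /S (exchange_big_dep xpredT) //=; apply: eq_bigr => a _.
  by apply: eq_big => b; rewrite addnC.
rewrite dsum_exchange -!big_split big_nat_cond big1 // => a.
rewrite andbT => /andP[a0 ap] /=.
rewrite -big_split /= [X in _ + X]sum_rev -[X in X + _]addr0.
rewrite [X in _ + 0 + X](_ : _ = \sum_(1 <= b < p | (a + b < p)%N)
    - (phi a b / (a%:R * b%:R))); last first.
  rewrite big_nat_cond [RHS]big_nat_cond; apply: eq_big => b.
    by apply: andb_id2l => /andP[b0 bp]; lia.
  move=> /andP[/andP[b0 bp] _].
  by rewrite natrB_char 1?ltnW // subKn 1?ltnW // mulrN invrN mulrN.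
rewrite addr0 -big_split big_nat_cond big1 //= => b.
move=> /andP[/andP[b0 bp] abp].
have a0' : a%:R != 0 :> K by rewrite natr_neq0 ?a0.
have b0' : b%:R != 0 :> K by rewrite natr_neq0 ?b0.
have ab0 : (a + b)%:R != 0 :> K by rewrite natr_neq0 // abp addn_gt0 a0.
rewrite natrD in ab0 *; field.
by rewrite a0' b0' ab0.
Qed.

(** * Relations between parity-weighted sums for p > 3 *)

Hypothesis p_gt3 : (3 < p)%N.

(** For odd p this is (-1)^((p-1)/2), that is, [chi p]. The exponent is a parity bit so that it can
    be settled by cases. *)
Let eps : K := (-1) ^+ odd p./2.

Lemma odd_char : odd p.
Proof.
have /andP[p_pr _] := pK; have [p2|//] := even_prime p_pr.
by move: p_gt3; rewrite p2.
Qed.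

Lemma natr2_neq0 : 2%:R != 0 :> K.
Proof. by rewrite natr_neq0 //= ltnW. Qed.

Lemma natr3_neq0 : 3%:R != 0 :> K.
Proof. by rewrite natr_neq0. Qed.

(** Once the parities of differences are expanded, both sides depend on finitely many parity bits,
    and all cases are checked. *)
Ltac by_parity :=
  rewrite /evenr /oddr /psi /chi /eps ?oddB ?odd_halfB ?odd_char //;
  repeat match goal with |- context [odd ?n] => case: (odd n) => /= end;
  rewrite ?(expr0, expr1, mulr0, mul0r, mulr1, mul1r, mulrN1, mulN1r, mulNr,
            mulrN, opprK, oppr0, addr0, add0r) //.

Lemma add3r_eq0 (x : K) : x + x + x = 0 -> x = 0.
Proof.
have -> : x + x + x = 3%:R * x by ring.
by move/eqP; rewrite mulf_eq0 (negPf natr3_neq0) => /eqP.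
Qed.

Lemma add2r_eq0 (x : K) : x + x = 0 -> x = 0.
Proof.
rewrite -mulr2n -mulr_natl => /eqP.
by rewrite mulf_eq0 (negPf natr2_neq0) => /eqP.
Qed.

(** Reflection equates the odd and even parts, so each is half of the sum of all 1/n^2. That sum
    vanishes by shuffle and stuffle with constant weight 1, after division by 3. *)
Lemma hsum2_oddr : hsum2 oddr = 0.
Proof.
pose one_ (n : nat) : K := 1.
have h1 : hsum one_ = 0.
  by apply: add2r_eq0; rewrite [X in X + _]hsum_rev addNr.
have d1 : dsum (fun m n => one_ m * one_ n) = 0.
  exact/add3r_eq0/(dsum_shuffle (fun m n => one_ m * one_ n)).
have /eqP := dsum_stuffle one_ one_; rewrite d1 h1 mulr0 !add0r => /eqP s1.
have : hsum2 (fun n => one_ n * one_ n) = hsum2 oddr + hsum2 oddr.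
  rewrite [X in _ + X]hsum2_rev -hsum2D; apply: eq_hsum2 => n n0 np.
  by rewrite /one_; by_parity.
by rewrite s1 => /esym/add2r_eq0.
Qed.

(** With both shuffle arguments odd, all three terms reduce to the same sum, since n is a sum of two
    odd numbers or p minus an odd number. *)
Lemma dsum_oddr_evenr : dsum (fun m n => oddr m * evenr n) = 0.
Proof.
have := dsum_shuffle (fun m n => oddr m * oddr n).
rewrite (@eq_dsum _ (fun m n => oddr m * evenr n)); last first.
  by move=> m n m0 mn mp np; by_parity.
rewrite [X in _ + X + _](@eq_dsum _ (fun m n => oddr m * evenr n)); last first.
  by move=> m n m0 mn mp np; by_parity.
rewrite [X in _ + X](@eq_dsum _ (fun m n => oddr m * evenr n)); last first.
  by move=> m n m0 mn mp np; by_parity.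
exact: add3r_eq0.
Qed.

Lemma dsum_oddr_psi :
  dsum (fun m n => oddr m * psi n) = eps * dsum (fun m n => chi m * evenr n).
Proof.
rewrite -dsumZ [LHS]dsum_rev; apply: eq_dsum => m n m0 mn mp np.
by by_parity.
Qed.

(** This relation and the next two are the shuffle identity for the weights chi(a) odd(b), chi(a)
    even(b) and chi(a) psi(b); the parities of a and b fix those of m and n. *)
Lemma dsum_chi_psi :
  dsum (fun m n => chi m * psi n) = 2%:R * dsum (fun m n => chi m * evenr n).
Proof.
have := dsum_shuffle (fun m n => chi m * oddr n).
rewrite (@eq_dsum _ (fun m n => chi m * evenr n)); last first.
  by move=> m n m0 mn mp np; by_parity.
rewrite [X in _ + X + _](@eq_dsum _ (fun m n => (-1) * (chi m * psi n))); last first.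
  by move=> m n m0 mn mp np; by_parity.
rewrite [X in _ + X](@eq_dsum _ (fun m n => chi m * evenr n)); last first.
  by move=> m n m0 mn mp np; by_parity.
rewrite dsumZ mulN1r addrAC => /subr0_eq <-.
by rewrite mulr_natl mulr2n.
Qed.

Lemma dsum_psi_chi :
  dsum (fun m n => psi m * chi n) = - 2%:R * dsum (fun m n => chi m * oddr n).
Proof.
have := dsum_shuffle (fun m n => chi m * evenr n).
rewrite (@eq_dsum _ (fun m n => chi m * oddr n)); last first.
  by move=> m n m0 mn mp np; by_parity.
rewrite [X in _ + X + _](@eq_dsum _ (fun m n => psi m * chi n)); last first.
  by move=> m n m0 mn mp np; by_parity.
rewrite [X in _ + X](@eq_dsum _ (fun m n => chi m * oddr n)); last first.
  by move=> m n m0 mn mp np; by_parity.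
rewrite addrAC => /eqP; rewrite addrC addr_eq0 => /eqP ->.
by rewrite mulNr mulr_natl mulr2n.
Qed.

Lemma dsum_chi_chi :
  dsum (fun m n => oddr m * chi n) + dsum (fun m n => evenr m * chi n) =
  - (eps * dsum (fun m n => chi m * chi n)).
Proof.
have := dsum_shuffle (fun m n => chi m * psi n).
rewrite (@eq_dsum _ (fun m n => oddr m * chi n)); last first.
  by move=> m n m0 mn mp np; by_parity.
rewrite [X in _ + X + _](@eq_dsum _ (fun m n => evenr m * chi n)); last first.
  by move=> m n m0 mn mp np; by_parity.
rewrite [X in _ + X](@eq_dsum _ (fun m n => eps * (chi m * chi n))); last first.
  by move=> m n m0 mn mp np; by_parity.
by rewrite dsumZ => /eqP; rewrite addr_eq0 => /eqP.
Qed.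

Lemma hsum_psi : hsum psi = - (eps * hsum chi).
Proof.
rewrite hsum_rev -hsumZ; congr (- _); apply: eq_hsum => n n0 np.
by by_parity.
Qed.

Lemma hsum_evenr : hsum evenr = - hsum oddr.
Proof.
rewrite hsum_rev; congr (- _); apply: eq_hsum => n n0 np.
by by_parity.
Qed.

(** Four stuffle products are combined with the shuffle relations. The products of single sums
    cancel because [hsum evenr] is minus [hsum oddr] and [hsum psi] is minus eps times
    [hsum chi]. *)
Lemma dsum_chi_evenr :
  2%:R * dsum (fun m n => chi m * evenr n) = - hsum2 chi.
Proof.
have := dsum_stuffle chi oddr; have := dsum_stuffle chi evenr.
have := dsum_stuffle chi chi; have := dsum_stuffle psi chi.
rewrite (@eq_hsum2 (fun n => psi n * chi n) (fun n => 0 * 0)); last first.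
  by move=> n _ _; by_parity.
rewrite (@eq_hsum2 (fun n => chi n * chi n) oddr); last first.
  by move=> n _ _; by_parity.
rewrite (@eq_hsum2 (fun n => chi n * evenr n) (fun n => 0 * 0)); last first.
  by move=> n _ _; by_parity.
rewrite (@eq_hsum2 (fun n => chi n * oddr n) chi); last first.
  by move=> n _ _; by_parity.
have -> : hsum2 (fun n => 0 * 0) = 0.
  by rewrite /hsum2 big1 // => n _; rewrite !mul0r.
rewrite hsum2_oddr dsum_psi_chi dsum_chi_psi hsum_psi hsum_evenr.
move: dsum_chi_chi => c1 c2 c3 c4 c5.
apply: (mulfI natr2_neq0); move: c1 c2 c3 c4 c5.
set x := dsum (fun m n => chi m * evenr n).
set Z := dsum (fun m n => evenr m * _).
set U := dsum (fun m n => chi m * oddr n).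
set V := dsum (fun m n => oddr m * _).
set CC := dsum _ => c1 c2 c3 c4 c5.
(* The brackets come from the stuffles chi-evenr and chi-oddr, the relation [dsum_chi_chi], and the
   stuffles psi-chi and chi-chi. Each bracket vanishes, and the coefficients are chosen to eliminate
   [Z], [U], [V] and [CC]. *)
have -> : 2%:R * (2%:R * x) = 2%:R * - hsum2 chi
    + (2%:R * (x + Z + 0) - 2%:R * (hsum chi * - hsum oddr))
    + (2%:R * (U + V + hsum2 chi) - 2%:R * (hsum chi * hsum oddr))
    - (2%:R * (V + Z) - 2%:R * - (eps * CC))
    + (- 2%:R * U + 2%:R * x + 0 - - (eps * hsum chi) * hsum chi)
    + (eps * (CC + CC + 0) - eps * (hsum chi * hsum chi)) by ring.
by rewrite c1 c2 c3 c4 c5 !subrr !addr0 subr0.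
Qed.

(** * Binomial coefficients modulo p, Fermat quotient and Euler numbers *)

Lemma bin_pred_char k : (k < p)%N -> 'C(p.-1, k)%:R = (-1) ^+ k :> K.
Proof.
have p_gt0 : (0 < p)%N by apply: leq_trans p_gt3.
have /andP[p_pr _] := pK.
elim: k => [|k IHk] kp; first by rewrite bin0 expr0.
have : 'C(p, k.+1)%:R = 0 :> K.
  by apply/eqP; rewrite -(dvdn_pcharf pK) prime_dvd_bin.
rewrite -(prednK p_gt0) binS natrD IHk 1?ltnW // => /eqP.
by rewrite addr_eq0 => /eqP ->; rewrite exprS mulN1r.
Qed.

(** Divide k C(p, k) = p C(p-1, k-1) by p in the integers and only then reduce modulo p. *)
Lemma bin_char_div k : (0 < k < p)%N ->
  ('C(p, k) %/ p)%:R = (-1) ^+ k.-1 / k%:R :> K.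
Proof.
case: k => // k kp; have /andP[p_pr _] := pK.
have k_neq0 : k.+1%:R != 0 :> K by rewrite natr_neq0.
apply: (canRL (mulfK k_neq0)); rewrite -natrM -bin_pred_char 1?ltnW //.
congr (_%:R); apply/eqP; rewrite -(eqn_pmul2l (prime_gt0 p_pr)).
by rewrite mul_bin_diag mulnA [(p * _)%N]mulnC divnK ?prime_dvd_bin // mulnC.
Qed.

(** Kept over the integers, so that the factor p can later be cancelled before reduction; this
    encodes congruences modulo p^2. *)
Lemma sum_bin_char (f : nat -> int) :
  \sum_(k < p.+1) f k * 'C(p, k)%:R =
  f 0 + f p + p%:R * \sum_(1 <= k < p) f k * ('C(p, k) %/ p)%:R.
Proof.
have /andP[p_pr _] := pK; have p_gt0 := prime_gt0 p_pr.
rewrite -(big_mkord xpredT (fun k => f k * 'C(p, k)%:R)) big_nat_recr //=.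
rewrite big_ltn // binn bin0 !mulr1 addrAC; congr (_ + _).
rewrite mulr_sumr; apply: eq_big_nat => k kp.
by rewrite mulrCA -natrM mulnC divnK // prime_dvd_bin.
Qed.

Lemma hsum_bin_char (f : nat -> int) :
  (\sum_(1 <= k < p) f k * ('C(p, k) %/ p)%:R)%:~R =
  hsum (fun k => (-1) ^+ k.-1 * (f k)%:~R).
Proof.
rewrite rmorph_sum; apply: eq_big_nat => k kp /=.
by rewrite rmorphM /= rmorph_nat bin_char_div // mulrA [_ * (-1) ^+ _]mulrC.
Qed.

Let fermat2 : nat := ((2 ^ p.-1 - 1) %/ p)%N.

Lemma natr_fermat n : (0 < n < p)%N -> n%:R ^+ p.-1 = 1 :> K.
Proof.
move=> np; have p_gt0 : (0 < p)%N by apply: leq_trans p_gt3.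
apply: (mulIf (natr_neq0 np)); rewrite -exprSr prednK // mul1r.
by rewrite -(pFrobenius_autE pK) pFrobenius_aut_nat.
Qed.

Lemma fermat2E : 2 ^+ p.-1 = 1 + p%:R * fermat2%:R :> int.
Proof.
have dv : (p %| 2 ^ p.-1 - 1)%N.
  rewrite (dvdn_pcharf pK) natrB ?expn_gt0 // natrX.
  by rewrite (natr_fermat (n := 2)) ?subrr //= ltnW.
rewrite -natrM mulnC /fermat2 divnK // natrB ?expn_gt0 // addrC subrK.
by rewrite natrX.
Qed.

Lemma hsum_oddr : hsum oddr = fermat2%:R.
Proof.
have /andP[p_pr _] := pK; have p_gt0 := prime_gt0 p_pr.
have := sum_bin_char (fun=> 1).
rewrite (_ : \sum_(k < _) _ = 2 * (1 + p%:R * fermat2%:R)); last first.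
  rewrite -fermat2E -exprS prednK // -natrX (Pascal 1 1) natr_sum.
  by apply: eq_bigr => k _; rewrite !exp1n mul1r !muln1.
(* Cancel the end terms 1 + 1 and then p. *)
rewrite mulrDr mulr1 => /addrI; rewrite mulrCA => /mulfI.
rewrite pnatr_eq0 -lt0n p_gt0 => /(_ isT)/(congr1 (fun z : int => z%:~R : K)).
rewrite hsum_bin_char rmorphM /= !rmorph_nat => E; apply: (mulfI natr2_neq0).
(* The alternating sum is the odd part minus the even part, which is twice the odd part by
   reflection. *)
rewrite E; transitivity (hsum (fun n => oddr n + -1 * evenr n)).
  by rewrite hsumD hsumZ hsum_evenr; ring.
apply: eq_hsum => -[//|n] _ _; rewrite /oddr /evenr /= negbK mulr1 -signr_odd.
by case: (odd n); rewrite /= ?expr0 ?expr1 ?mulr0 ?mulr1 ?addr0 ?add0r.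
Qed.

Lemma hsum_chi : 2%:R * (eps * hsum chi) = fermat2%:R.
Proof.
have /andP[p_pr _] := pK; have p_gt0 := prime_gt0 p_pr.
have pE : p = p./2.*2.+1 by have := odd_char; lia.
have := (sum_bin_chi_psi p./2).1; rewrite -pE sum_bin_char.
have -> : p./2.*2 = p.-1 by rewrite [in RHS]pE.
rewrite fermat2E; have -> : chi 0 = 0 :> int by [].
have -> : chi p = (-1) ^+ odd p./2 :> int by rewrite /chi odd_char mul1r.
set C := \sum_(_ <= _ < _) _; set e : int := (-1) ^+ _ => CE.
have e2 : e * e = 1 by rewrite -expr2 /e sqrr_sign.
(* The imaginary part of (1 + i)^p is e + p C. Its square 1 + p (2 e C + p C^2) is compared with
   2^(p-1) = 1 + p [fermat2]; reduction modulo p then kills p C^2. *)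
have : p%:R * (2 * e * C + p%:R * C ^+ 2) = p%:R * fermat2%:R.
  apply: (addrI 1); rewrite -CE.
  have -> : (0 + e + p%:R * C) ^+ 2 =
    e * e + p%:R * (2 * e * C + p%:R * C ^+ 2) by ring.
  by rewrite e2.
move/mulfI; rewrite pnatr_eq0 -lt0n p_gt0 => /(_ isT).
move/(congr1 (fun z : int => z%:~R : K)).
rewrite rmorphD !rmorphM /= rmorph_sign !rmorph_nat (pcharf0 pK) mul0r addr0.
rewrite hsum_bin_char -mulrA -/eps => <-; congr (_ * (_ * _)).
apply: eq_hsum => -[//|n] _ _; rewrite /chi /= -[(-1) ^+ n]signr_odd.
case: (odd n); rewrite /= ?mul0r ?mulr0 // expr0 !mul1r.
by rewrite rmorph_sign.
Qed.

(** By Fermat, 1/n^2 = n^(p-3), so this is an alternating sum of odd powers with 2N = p - 1, which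
    is -1 in K. The boundary term vanishes because p - 3 is even and positive. *)
Lemma hsum2_chi : 2%:R * hsum2 chi = eulerK K (p - 3).
Proof.
have pE : p = p./2.*2.+1 by have := odd_char; lia.
transitivity (2%:R * \sum_(1 <= n < p) chi n * n%:R ^+ (p - 3) : K).
  congr (_ * _); apply: eq_big_nat => n np; congr (_ * _).
  have n2_neq0 : n%:R ^+ 2 != 0 :> K by rewrite expf_neq0 // natr_neq0.
  apply: (mulIf n2_neq0); rewrite mulVf // -exprD.
  by rewrite (_ : (p - 3 + 2 = p.-1)%N) ?natr_fermat //; lia.
have := sum_chi (fun n => n%:R ^+ (p - 3) : K) p./2; rewrite -pE => ->.
rewrite sum_odd_pow.
have -> : p./2.*2%:R = -1 :> K.
  by apply/eqP; rewrite -addr_eq0 natr1 -pE (pcharf0 pK).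
rewrite umbral_opp1 ?mulr0 ?subr0 ?natr2_neq0 //; first by lia.
by rewrite oddB 1?ltnW // odd_char.
Qed.

End HarmonicSums.

(** * Components of alternating T-values *)

Lemma T_index1 (n : 'I_1 -> nat) : T_index n = odd (n ord0).
Proof.
apply/and3P/idP => [[_ _ /forallP/(_ ord0)]|n_odd].
  by rewrite subn0 (modn_small (isT : 1 < 2)%N) modn2; case: odd.
split; apply/forallP => i; rewrite ?(ord1 i).
- by apply/forallP => j; rewrite (ord1 j).
- exact: odd_gt0.
- by rewrite subn0 modn2 n_odd.
Qed.

(** [ord0] carries the larger, even index and [ord_max] the smaller, odd one. Positivity follows
    from oddness and the ordering. *)
Lemma T_index2 (n : 'I_2 -> nat) :
  T_index n = [&& odd (n ord_max), ~~ odd (n ord0) & (n ord_max < n ord0)%N].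
Proof.
apply/and3P/and3P => [[/forallP/(_ ord0)/forallP/(_ ord_max) /= lt _ /forallP par]|].
  have := par ord0; have := par ord_max; rewrite /= subn0 !modn2.
  by case: (odd (n ord_max)) => //= _; case: (odd (n ord0)).
move=> [odd1 even0 lt]; have gt0 := odd_gt0 odd1.
have ordP (P : 'I_2 -> bool) : P ord0 -> P ord_max -> forall i, P i.
  move=> P0 P1 i; case: (unliftP ord0 i) => [j|] -> //.
  by rewrite (_ : lift _ _ = ord_max) //; apply/val_inj; rewrite /= (ord1 j).
split; apply/forallP; apply/ordP.
- by apply/forallP; apply/ordP.
- by apply/forallP; apply/ordP.
- exact: leq_trans lt.
- by [].
- by rewrite /= subn0 modn2 (negPf even0).
- by rewrite /= modn2 odd1.
Qed.

Lemma sum_T_index1 (R : nmodType) p (F : nat -> R) :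
  \sum_(n : {ffun 'I_1 -> 'I_p} | T_index (fun j => n j : nat)) F (n ord0) =
  \sum_(1 <= n < p | odd n) F n.
Proof.
rewrite (reindex (fun i : 'I_p => [ffun=> i])) /=; last first.
  exists (fun n => n ord0) => [i _|n _]; first by rewrite ffunE.
  by apply/ffunP => j; rewrite ffunE (ord1 j).
rewrite (big_nat_widenl _ 0) // big_mkord; apply: eq_big => i.
  by rewrite T_index1 ffunE; case: (nat_of_ord i) => // n; rewrite andbT.
by rewrite ffunE.
Qed.

Lemma sum_T_index2 (R : nmodType) p (F : nat -> nat -> R) :
  \sum_(n : {ffun 'I_2 -> 'I_p} | T_index (fun j => n j : nat))
    F (n ord_max) (n ord0) =
  \sum_(1 <= n < p | ~~ odd n) \sum_(1 <= m < p | odd m && (m < n)%N) F m n.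
Proof.
pose h (u : 'I_p * 'I_p) := [ffun i : 'I_2 => if i == ord0 then u.1 else u.2].
rewrite (reindex h) /=; last first.
  exists (fun n => (n ord0, n ord_max)) => [[i j] _|n _]; first by rewrite !ffunE.
  apply/ffunP => i; rewrite ffunE /=; case: eqP => [->//|/eqP i0].
  by congr (n _); apply/val_inj; case: i i0 => [[|[|]]].
rewrite (big_nat_widenl _ 0) // big_mkord.
under [RHS]eq_bigr => n _.
  rewrite (big_nat_widenl _ 0) // big_mkord; over.
rewrite pair_big_dep /=; apply: eq_big => [[i j]|[i j] _]; rewrite ?T_index2 !ffunE //=.
lia.
Qed.

(** * Linear spans and values in A *)

Section LinSpan.
Variables (R : pzRingType) (V : lmodType R).
Implicit Types S : set V.

Lemma lin_span_sub S v : S v -> lin_span S v.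
Proof.
move=> Sv; exists 1%N, (fun=> 1), (fun=> v); split=> //.
by rewrite big_ord1 scale1r.
Qed.

Lemma lin_span0 S : lin_span S 0.
Proof.
exists 0%N, (fun=> 0), (fun=> 0); split; first by case.
by rewrite big_ord0.
Qed.

Lemma lin_spanD S u v : lin_span S u -> lin_span S v -> lin_span S (u + v).
Proof.
move=> [m [c [x [Sx ->]]]] [n [d [y [Sy ->]]]].
pose glue T (f : 'I_m -> T) (g : 'I_n -> T) (i : 'I_(m + n)) :=
  match fintype.split i with inl j => f j | inr j => g j end.
exists (m + n)%N, (glue _ c d), (glue _ x y); split.
  by move=> i; rewrite /glue; case: fintype.split.
rewrite big_split_ord /=; congr (_ + _); apply: eq_bigr => i _.
  by rewrite /glue -[lshift _ _]/(unsplit (inl i)) unsplitK.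
by rewrite /glue -[rshift _ _]/(unsplit (inr i)) unsplitK.
Qed.

Lemma lin_spanZ S a v : lin_span S v -> lin_span S (a *: v).
Proof.
move=> [m [c [x [Sx ->]]]]; exists m, (fun i => a * c i), x; split=> //.
by rewrite scaler_sumr; apply: eq_bigr => i _; rewrite scalerA.
Qed.

Lemma lin_span_min S S' :
  (S `<=` lin_span S')%classic -> (lin_span S `<=` lin_span S')%classic.
Proof.
move=> SS' _ [m [c [x [Sx ->]]]].
apply: (big_ind (lin_span S')); [exact: lin_span0 | exact: lin_spanD |].
by move=> i _; apply/lin_spanZ/SS'.
Qed.

Lemma lin_span_eq S S' :
  (S `<=` lin_span S')%classic -> (S' `<=` lin_span S)%classic ->
  lin_span S = lin_span S'.
Proof. by move=> SS' S'S; apply/seteqP; split; apply: lin_span_min. Qed.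

End LinSpan.

(** * From identities at primes above 3 to identities in A *)

Lemma eq_toA (f g : prodF) :
  (forall p : prime_index, (3 < val p)%N -> f p = g p) -> toA f = toA g.
Proof. by move=> fg; apply/toA_eqP; exists 3%N. Qed.

Lemma add_half (a b : A) : a + a = b -> a = 2^-1 *: b.
Proof. by move=> <-; rewrite -mulr2n -scaler_nat scalerA mulVf ?scale1r. Qed.

Lemma ratr_half (F : fieldType) (x : rat) : x \is a Num.int ->
  2 != 0 :> F -> ratr (x / 2) = (numq x)%:~R / 2 :> F.
Proof.
move=> x_int two_neq0; apply: (@ratr_frac F (numq x) 2) => //; last first.
  by rewrite divfK // numqK.
have dvd2 : (`|denq (x / 2)| %| 2)%N.
  (* The denominator divides twice the numerator since x is an integer; being coprime to the
     numerator, it divides 2. *)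
  rewrite -(Gauss_dvdr (n := `|numq (x / 2)|)) 1?coprime_sym ?coprime_num_den //.
  rewrite -[2%N]/(`|2%:Z|)%N -abszM.
  apply/dvdnP; exists `|numq x|%N; rewrite -abszM; congr (absz _).
  apply: (@intr_inj rat); rewrite !rmorphM /= numqE numqK //.
  by rewrite mulrAC divfK.
case: (denq _) (denq_gt0 (x / 2)) dvd2 => // [[|[|[|n]]]] //= _.
by rewrite oner_eq0.
Qed.

Lemma T_A1E (s : 'I_1 -> nat) sigma : T_A s sigma = toA (fun p =>
  \sum_(1 <= n < val p) oddr n * (sigma ord0)%:~R ^+ n./2 / n%:R ^+ s ord0) :> A.
Proof.
apply: eq_toA => p _.
under eq_bigr => n _ do rewrite big_ord1.
pose F n : 'F_(val p) := (sigma ord0)%:~R ^+ (n - 1)./2 / n%:R ^+ s ord0.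
rewrite (sum_T_index1 _ F) {}/F.
rewrite big_mkcond; apply: eq_bigr => n _; rewrite /oddr.
case: (boolP (odd n)) => n_odd; rewrite ?mul0r // mul1r; congr (_ ^+ _ / _).
by lia.
Qed.

(** The exponents (m-1)/2 and (n-2)/2 are [m./2] for odd m and [n./2.-1] for even n; the parity
    conditions move into the weights. *)
Lemma T_A2E (s : 'I_2 -> nat) sigma : s ord0 = 1%N -> s ord_max = 1%N ->
  T_A s sigma = toA (fun p =>
  dsum (val p) (fun m n => (oddr m * (sigma ord_max)%:~R ^+ m./2) *
     (evenr n * (sigma ord0)%:~R ^+ n./2.-1))).
Proof.
move=> s0 s1; apply: eq_toA => p _; set K := 'F_(val p).
pose F m n : K := (sigma ord0)%:~R ^+ (n - 2)./2 / n%:R *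
  ((sigma ord_max)%:~R ^+ (m - 1)./2 / m%:R).
transitivity (\sum_(n : {ffun 'I_2 -> 'I_(val p)} | T_index (fun j => n j : nat))
    F (n ord_max) (n ord0)).
  apply: eq_bigr => n _; rewrite big_ord_recl big_ord1 /F.
  rewrite (_ : lift _ _ = ord_max) ?s0 ?s1 ?expr1 //.
  exact/val_inj.
rewrite sum_T_index2 big_mkcond; apply: eq_bigr => n _.
rewrite /evenr; case: (boolP (odd n)) => n_odd /=.
  by rewrite big1 // => m _; rewrite !mul0r mulr0 mul0r.
rewrite big_mkcond [RHS]big_mkcond; apply: eq_bigr => m _ /=.
rewrite /oddr; case: (boolP (odd m)) => m_odd /=; last first.
  by rewrite !mul0r; case: ifP.
case: ifP => // mn; rewrite !mul1r /F mulf_div [_ * m%:R]mulrC [_ ^+ _ * _]mulrC.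
by congr (_ ^+ _ * _ ^+ _ / _); lia.
Qed.

Lemma oddr_sign (R : pzRingType) n : oddr n * (-1)%:~R ^+ n./2 = chi n :> R.
Proof. by rewrite rmorphN1 -signr_odd. Qed.

(** The exponent is one less than that in [psi], which gives the minus sign. At n = 0 the
    predecessor would truncate. *)
Lemma evenr_sign (R : pzRingType) n : (0 < n)%N ->
  evenr n * (-1)%:~R ^+ n./2.-1 = - psi n :> R.
Proof.
rewrite rmorphN1 /evenr /psi => n_gt0.
case: (boolP (odd n)) => n_odd /=; first by rewrite !mul0r oppr0.
have -> : n./2 = n./2.-1.+1 by lia.
by rewrite signr_odd exprS mulN1r mulrN opprK.
Qed.

Lemma q2_A_hsum : q2_A = toA (fun p => hsum (val p) oddr).
Proof.
by apply: eq_toA => p p_gt3; rewrite (hsum_oddr (pchar_Fp (valP p))).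
Qed.

Lemma sgn_F (p : prime_index) : (3 < val p)%N ->
  (-1) ^+ (val p).-1./2 = (-1) ^+ odd (val p)./2 :> 'F_(val p).
Proof.
move=> p_gt3; have := odd_char (pchar_Fp (valP p)) p_gt3.
by rewrite signr_odd => p_odd; congr (_ ^+ _); lia.
Qed.

Lemma hsum_chi_A :
  toA (fun p => hsum (val p) chi) = 2^-1 *: (sgn_A * q2_A).
Proof.
apply: add_half; rewrite toAD toAM; apply: eq_toA => p p_gt3.
rewrite sgn_F // -(hsum_chi (pchar_Fp (valP p)) p_gt3) mulrCA.
by rewrite [_ * (_ * hsum _ _)]mulrA -expr2 sqrr_sign mul1r mulr_natl mulr2n.
Qed.

Lemma G_A_hsum2 : G_A = toA (fun p => hsum2 (val p) chi).
Proof.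
apply: eq_toA => p p_gt3; have pF := pchar_Fp (valP p).
have two_neq0 := natr2_neq0 pF p_gt3.
rewrite ratr_half ?euler_number_int //.
rewrite -[(numq _)%:~R]/(eulerK _ (val p - 3)) -(hsum2_chi pF p_gt3).
by rewrite mulrAC mulfV // mul1r.
Qed.

Lemma toA0 : toA (fun p => 0) = 0.
Proof. exact: (rmorph0 (\pi_({ideal_quot dsumF})%qT)). Qed.

Lemma hsum2_oddr_A : toA (fun p => hsum2 (val p) oddr) = 0.
Proof.
rewrite -toA0; apply: eq_toA => p p_gt3.
exact: (hsum2_oddr (pchar_Fp (valP p))).
Qed.

(** * Values of the T-values in depths one and two *)

Lemma T_A1_1 (s : 'I_1 -> nat) sigma : sigma ord0 = 1 ->
  T_A s sigma = toA (fun p =>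
    \sum_(1 <= n < val p) oddr n / n%:R ^+ s ord0) :> A.
Proof.
move=> s1; rewrite T_A1E; apply: eq_toA => p _; apply: eq_bigr => n _.
by rewrite s1 expr1n mulr1.
Qed.

Lemma T_A1_N1 (s : 'I_1 -> nat) sigma : sigma ord0 = -1 ->
  T_A s sigma = toA (fun p =>
    \sum_(1 <= n < val p) chi n / n%:R ^+ s ord0) :> A.
Proof.
move=> s1; rewrite T_A1E; apply: eq_toA => p _; apply: eq_bigr => n _.
by rewrite s1 oddr_sign.
Qed.

Lemma T_A_11_1_1 (s : 'I_2 -> nat) sigma : s ord0 = 1%N -> s ord_max = 1%N ->
  sigma ord0 = 1 -> sigma ord_max = 1 -> T_A s sigma = 0.
Proof.
move=> s0 s1 e0 e1; rewrite (T_A2E _ s0 s1) -toA0; apply: eq_toA => p p_gt3.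
rewrite -[RHS](dsum_oddr_evenr (pchar_Fp (valP p)) p_gt3); apply: eq_dsum => *.
by rewrite e0 e1 !expr1n !mulr1.
Qed.

Lemma T_A_11_1_N1 (s : 'I_2 -> nat) sigma : s ord0 = 1%N -> s ord_max = 1%N ->
  sigma ord0 = 1 -> sigma ord_max = -1 -> T_A s sigma = 2^-1 *: (-1 *: G_A).
Proof.
move=> s0 s1 e0 e1; apply/add_half/eqP; rewrite scaleN1r -addr_eq0; apply/eqP.
rewrite (T_A2E _ s0 s1) G_A_hsum2 !toAD -toA0; apply: eq_toA => p p_gt3.
rewrite (@eq_dsum _ _ _ (fun m n => chi m * evenr n)); last first.
  by move=> m n *; rewrite e0 e1 oddr_sign expr1n mulr1.
rewrite -mulr2n -mulr_natl (dsum_chi_evenr (pchar_Fp (valP p)) p_gt3).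
by rewrite addNr.
Qed.

Lemma T_A_11_N1_1 (s : 'I_2 -> nat) sigma : s ord0 = 1%N -> s ord_max = 1%N ->
  sigma ord0 = -1 -> sigma ord_max = 1 -> T_A s sigma = 2^-1 *: (sgn_A * G_A).
Proof.
move=> s0 s1 e0 e1; apply/add_half.
rewrite (T_A2E _ s0 s1) G_A_hsum2 toAD toAM; apply: eq_toA => p p_gt3.
have pF := pchar_Fp (valP p).
rewrite sgn_F // (@eq_dsum _ _ _ (fun m n => -1 * (oddr m * psi n))).
  rewrite dsumZ (dsum_oddr_psi pF p_gt3) -(mulr2n (-1 * _)) -mulr_natl.
  rewrite mulN1r mulrN mulrCA (dsum_chi_evenr pF p_gt3) mulrN opprK //.
move=> m n m0 mn _ _; rewrite e0 e1 expr1n mulr1 evenr_sign ?(leq_trans m0) //.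
by rewrite mulrN mulN1r.
Qed.

Lemma T_A_11_N1_N1 (s : 'I_2 -> nat) sigma : s ord0 = 1%N -> s ord_max = 1%N ->
  sigma ord0 = -1 -> sigma ord_max = -1 -> T_A s sigma = G_A.
Proof.
move=> s0 s1 e0 e1; rewrite (T_A2E _ s0 s1) G_A_hsum2; apply: eq_toA => p p_gt3.
have pF := pchar_Fp (valP p).
rewrite (@eq_dsum _ _ _ (fun m n => -1 * (chi m * psi n))).
  rewrite dsumZ (dsum_chi_psi pF p_gt3) (dsum_chi_evenr pF p_gt3).
  by rewrite mulN1r opprK.
move=> m n m0 mn _ _; rewrite e0 e1 oddr_sign evenr_sign ?(leq_trans m0) //.
by rewrite mulrN mulN1r.
Qed.

(** * Generating sets in weights one and two *)

Lemma depth_le_weight d (s : 'I_d -> nat) :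
  (forall j, 0 < s j)%N -> (d <= \sum_(j < d) s j)%N.
Proof.
by move=> s_gt0; rewrite -{1}(card_ord d) -sum1_card; apply: leq_sum.
Qed.

Local Open Scope classical_set_scope.

Lemma FAMT_depth1 w (e : int) : (0 < w)%N -> e = 1 \/ e = -1 ->
  FAMT w (T_A (fun _ : 'I_1 => w) (fun=> e)).
Proof.
move=> w_gt0 e_sign; apply: lin_span_sub.
by exists 1%N, (fun=> w), (fun=> e); split=> //; rewrite big_ord1.
Qed.

Lemma FAMT1 : FAMT 1 = lin_span [set q2_A; sgn_A * q2_A].
Proof.
apply: lin_span_eq => a.
  move=> [d [s [sigma [s_gt0 sigma_sign sw ->]]]].
  have := depth_le_weight s_gt0; rewrite sw.
  case: d s sigma s_gt0 sigma_sign sw => [|[|//]] s sigma s_gt0 sigma_sign.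
    by rewrite big_ord0.
  rewrite big_ord1 => s1 _; have [e|e] := sigma_sign ord0.
    rewrite (T_A1_1 _ e) s1 -[toA _]q2_A_hsum.
    by apply: lin_span_sub; left.
  rewrite (T_A1_N1 _ e) s1 [toA _]hsum_chi_A.
  by apply/lin_spanZ/lin_span_sub; right.
move=> [->|->].
  rewrite q2_A_hsum -[toA _](T_A1_1 (fun=> 1%N) (sigma := fun=> 1)) //.
  by apply: FAMT_depth1 => //; left.
(* The second generator is twice T(1; -1). *)
rewrite -[_ * _](scale1r) -(mulfV (x := 2)) // -scalerA -hsum_chi_A.
rewrite -[toA _](T_A1_N1 (fun=> 1%N) (sigma := fun=> -1)) //.
by apply/lin_spanZ/FAMT_depth1 => //; right.
Qed.

Lemma FAMT2 : FAMT 2 = lin_span [set G_A; sgn_A * G_A].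
Proof.
have G_span : lin_span [set G_A; sgn_A * G_A] G_A by apply: lin_span_sub; left.
have sG_span : lin_span [set G_A; sgn_A * G_A] (sgn_A * G_A).
  by apply: lin_span_sub; right.
apply: lin_span_eq => a.
  move=> [d [s [sigma [s_gt0 sigma_sign sw ->]]]].
  have := depth_le_weight s_gt0; rewrite sw.
  case: d s sigma s_gt0 sigma_sign sw => [|[|[|//]]] s sigma s_gt0 sigma_sign.
  - by rewrite big_ord0.
  - rewrite big_ord1 => s2 _; have [e|e] := sigma_sign ord0.
      by rewrite (T_A1_1 _ e) s2 [toA _]hsum2_oddr_A; apply: lin_span0.
    by rewrite (T_A1_N1 _ e) s2 -[toA _]G_A_hsum2.
  rewrite big_ord_recl big_ord1 (_ : lift _ _ = ord_max); last exact/val_inj.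
  have := s_gt0 ord0; have := s_gt0 ord_max => s1_gt0 s0_gt0 sw _.
  have s0 : s ord0 = 1%N by lia.
  have s1 : s ord_max = 1%N by lia.
  have [e0|e0] := sigma_sign ord0; have [e1|e1] := sigma_sign ord_max.
  - by rewrite T_A_11_1_1 //; apply: lin_span0.
  - by rewrite T_A_11_1_N1 //; do 2!apply: lin_spanZ.
  - by rewrite T_A_11_N1_1 //; apply: lin_spanZ.
  - by rewrite T_A_11_N1_N1.
move=> [->|->].
  rewrite G_A_hsum2 -[toA _](T_A1_N1 (fun=> 2%N) (sigma := fun=> -1)) //.
  by apply: FAMT_depth1 => //; right.
(* The second generator is twice T(1, 1; -1, 1), a value of depth two. *)
rewrite -[_ * _](scale1r) -(mulfV (x := 2)) // -scalerA.
rewrite -(@T_A_11_N1_1 (fun=> 1%N) (fun j => if j == ord0 then -1 else 1)) //.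
apply/lin_spanZ/lin_span_sub.
exists 2%N, (fun=> 1%N), (fun j => if j == ord0 then -1 else 1); split=> //.
  by move=> j; case: ifP; [right | left].
by rewrite big_ord_recl big_ord1.
Qed.

Theorem proposition4p5 :
  FAMT 1 = lin_span [set q2_A; sgn_A * q2_A] /\
  FAMT 2 = lin_span [set G_A; sgn_A * G_A].
Proof. by split; [exact: FAMT1 | exact: FAMT2]. Qed.
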